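(* Let $\Lambda \subseteq \omega_1$ be the set of limit ordinals, let $S \subseteq \Lambda$ be stationary, and let $(L_\alpha : \alpha \in S)$ be any ladder system. Let $\mathfrak{A}$ be the structure constructed from it in the context (in a language $\mathcal{L}$ of size continuum), and let $T$ be the complete theory of $\mathfrak{A}$. Then $\mathfrak{A}$ is the unique (up to isomorphism) atomic model of $T$, and $\mathfrak{A}$ is prime but not constructible.
   Context: A ladder system on stationary $S\subseteq \Lambda$ is a sequence $(L_\alpha : \alpha\in S)$ such that for each $\alpha\in S$, $L_\alpha\subset\alpha$ is cofinal in $\alpha$ and of order type $\omega$. Let $\nu_\alpha : \omega \to L_\alpha$ be the strictly increasing enumeration. Let $J_0$ be the set of all strictly increasing functions $\eta_0 : \alpha \to \omega_1$ with $\alpha \leq \omega$, such that if $\alpha = \omega$ then $\eta_0 = \nu_\beta$ for some $\beta \in S$. Let $J_1 = 2^{\leq \omega}$. Let $J = J_0 \otimes J_1$ be the set of pairs $\eta = (\eta_0, \eta_1)$ with $\eta_0 \in J_0$, $\eta_1 \in J_1$ and $\eta_0,\eta_1$ of the same length, denoted $\ell g(\eta)$; $\eta\restriction_\alpha = (\eta_0\restriction_\alpha, \eta_1\restriction_\alpha)$ (equal to $\eta$ if $\alpha \geq \ell g(\eta)$). Let $\mathcal{L} = \{U_{\eta_0}, \pi_\alpha, \boldsymbol{\eta} : \eta_0 \in J_0, \eta \in J, \alpha \leq \omega\}$, with each $U_{\eta_0}$ a unary predicate and each $\pi_\alpha$, $\boldsymbol{\eta}$ a unary function symbol. $\mathfrak{A}$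 is the $\mathcal{L}$-structure with universe $J$ where $U_{\eta_0} = \{\tau \in J : \tau_0 = \eta_0\}$; $\pi_\alpha(\eta) = \eta\restriction_\alpha$; and for $\eta, \tau \in J$ with $\eta_0 = \tau_0$, $\boldsymbol{\eta}(\tau) = (\eta_0, \eta_1 \oplus \tau_1)$, with pointwise addition mod 2 (the function $\boldsymbol{\eta}$ is regarded as a map $U_{\eta_0}\to U_{\eta_0}$ and takes trivial values, say as the identity, outside $U_{\eta_0}$). A model $M$ is atomic if every finite tuple from $M$ has its type over $\emptyset$ isolated by a single formula; $M$ is prime if for every $N\equiv M$ there is an elementary embedding of $M$ into $N$; $M$ is constructible if it can be enumerated as a sequence $M=(a_\alpha:\alpha<\alpha^* )$ such that each $tp(a_\alpha/\{a_\beta:\beta<\alpha\})$ is isolated by a single formula. *)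

(* Defs.v *)
From mathcomp Require Import all_boot all_order.
From mathcomp Require Import boolp classical_sets functions cardinality wochoice.

Set Implicit Arguments.
Unset Strict Implicit.
Unset Printing Implicit Defensive.

Local Open Scope classical_set_scope.
Local Open Scope card_scope.

Record language := Language {
  fsym : Type;
  farity : fsym -> nat;
  rsym : Type;
  rarity : rsym -> nat }.

Definition symbols (L : language) : Type := (fsym L + rsym L)%type.

Definition has_size_continuum (L : language) : Prop :=
  [set: symbols L] #= [set: nat -> bool].

Record structure (L : language) := Structure {
  carrier :> Type;
  fsem : forall f : fsym L, ('I_(farity f) -> carrier) -> carrier;
  rsem : forall r : rsym L, ('I_(rarity r) -> carrier) -> Prop }.

(** Terms and formulas are indexed by a number n of free variables, the elements
    of ['I_n]. *)
Inductive term (L : language) (n : nat) : Type :=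
| Var of 'I_n
| App (f : fsym L) of ('I_(farity f) -> term L n).

(** [All] binds the variable [ord0] of its argument; the free variable [i] of
    [All p] is the variable [lift ord0 i] of [p]. *)
Inductive formula (L : language) : nat -> Type :=
| Bot n : formula L n
| Eq n of term L n & term L n : formula L n
| Rel n (r : rsym L) of ('I_(rarity r) -> term L n) : formula L n
| Imp n of formula L n & formula L n : formula L n
| All n of formula L n.+1 : formula L n.

Definition env0 (T : Type) : 'I_0 -> T :=
  fun i => False_rect T (notF (ltn_ord i)).

Definition env_cons (T : Type) (n : nat) (x : T) (e : 'I_n -> T) :
    'I_n.+1 -> T :=
  fun i => oapp e x (unlift ord0 i).

Definition env_cat (T : Type) (n m : nat) (a : 'I_n -> T) (p : 'I_m -> T) :
    'I_(n + m) -> T :=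
  fun i => match fintype.split i with inl j => a j | inr k => p k end.

Section Semantics.
Variable L : language.

Fixpoint teval (M : structure L) (n : nat) (e : 'I_n -> M) (t : term L n) : M :=
  match t with
  | Var i => e i
  | App f ts => fsem (fun i => teval e (ts i))
  end.

Fixpoint satisfies (M : structure L) (n : nat) (p : formula L n) :
    ('I_n -> M) -> Prop :=
  match p in formula _ n return ('I_n -> M) -> Prop with
  | Bot _ => fun _ => False
  | Eq _ t u => fun e => teval e t = teval e u
  | Rel _ r ts => fun e => rsem (fun i => teval e (ts i))
  | Imp _ p q => fun e => satisfies p e -> satisfies q e
  | All _ p => fun e => forall x : M, satisfies p (env_cons x e)
  end.

Definition sentence := formula L 0.

Definition holds (M : structure L) (p : sentence) : Prop :=
  satisfies p (@env0 M).

Definition theory_of (M : structure L) : set sentence := [set p | holds M p].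

Definition is_model (M : structure L) (T : set sentence) : Prop :=
  forall p, T p -> holds M p.

Definition elementarily_equivalent (M N : structure L) : Prop :=
  forall p : sentence, holds M p <-> holds N p.

Definition elementary_embedding (M N : structure L) (h : M -> N) : Prop :=
  forall n (p : formula L n) (a : 'I_n -> M),
    satisfies p a <-> satisfies p (h \o a).

Definition isomorphism (M N : structure L) (h : M -> N) : Prop :=
  [/\ bijective h,
      forall (f : fsym L) (a : 'I_(farity f) -> M),
        h (fsem a) = fsem (h \o a)
    & forall (r : rsym L) (a : 'I_(rarity r) -> M),
        rsem a <-> rsem (h \o a)].

Definition isomorphic (M N : structure L) : Prop :=
  exists h : M -> N, isomorphism h.

(** A formula p(x, c) in n free variables x, with finitely many parameters c
    from A. *)
Record pformula (M : structure L) (A : set M) (n : nat) := PFormula {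
  pnum : nat;
  pbody : formula L (n + pnum);
  pparam : 'I_pnum -> M;
  pparamP : forall i, A (pparam i) }.

Definition psatisfies (M : structure L) (A : set M) (n : nat)
    (p : pformula A n) (a : 'I_n -> M) : Prop :=
  satisfies (pbody p) (env_cat a (@pparam _ _ _ p)).

Definition tp (M : structure L) (A : set M) (n : nat) (a : 'I_n -> M) :
    set (pformula A n) :=
  [set p | psatisfies p a].
Arguments tp {M} A {n} a.

(** A member p of the type t isolates t when, for every q in t, the sentence
    "for all x, p(x) implies q(x)" with parameters in A belongs to the complete
    theory of (M, c)_(c in A), i.e., when it is true in M. *)
Definition isolates (M : structure L) (A : set M) (n : nat)
    (p : pformula A n) (t : set (pformula A n)) : Prop :=
  t p /\ forall q, t q -> forall x : 'I_n -> M, psatisfies p x -> psatisfies q x.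

Definition isolated (M : structure L) (A : set M) (n : nat)
    (t : set (pformula A n)) : Prop :=
  exists p, isolates p t.

Definition atomic (M : structure L) : Prop :=
  forall n (a : 'I_n -> M), isolated (tp set0 a).

Definition prime_model (M : structure L) : Prop :=
  forall N : structure L, elementarily_equivalent N M ->
    exists h : M -> N, elementary_embedding h.

(** The ordinal indexing the enumeration is given as a well-ordered type. *)
Definition constructible (M : structure L) : Prop :=
  exists (d : Order.disp_t) (I : orderType d) (a : I -> M),
    [/\ well_order (<=%O : rel I),
        forall x : M, exists i, a i = x
      & forall i, isolated (tp (a @` [set j | (j < i)%O]) (fun _ : 'I_1 => a i))].

End Semantics.

(** Up to a unique isomorphism, omega_1 is the uncountable well-order all of
    whose proper initial segments are countable. *)
Definition is_omega1 (d : Order.disp_t) (W : orderType d) : Prop :=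
  [/\ well_order (<=%O : rel W),
      ~ countable [set: W]
    & forall a : W, countable [set b : W | (b < a)%O]].

Section Omega1.
Context {d : Order.disp_t} {W : orderType d}.
Implicit Types (S C A : set W) (a : W).

Definition cofinal_in A a : Prop :=
  forall b, (b < a)%O -> exists2 c, A c & (b < c < a)%O.

(** The ordinal 0 is not a limit ordinal. *)
Definition limit_ordinals : set W :=
  [set a | (exists b, (b < a)%O) /\ cofinal_in setT a].

Definition unbounded C : Prop := forall a, exists2 c, C c & (a < c)%O.

Definition closed C : Prop :=
  forall a, limit_ordinals a -> cofinal_in C a -> C a.

Definition club C : Prop := closed C /\ unbounded C.

Definition stationary S : Prop := forall C, club C -> S `&` C !=set0.

Definition increasing (f : nat -> W) : Prop :=
  {homo f : m n / (m < n)%N >-> (m < n)%O}.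

Definition enumerates (f : nat -> W) A : Prop :=
  increasing f /\ range f = A.

(** Only the values of [L] on [S] matter. *)
Definition ladder_system S (L : W -> set W) : Prop :=
  forall a, S a ->
    [/\ L a `<=` [set b | (b < a)%O],
        cofinal_in (L a) a
      & exists f, enumerates f (L a)].

End Omega1.

Inductive ord_le_omega := Nat of nat | Omega.

Inductive wseq (X : Type) : Type := FinSeq of seq X | OmegaSeq of (nat -> X).

Definition lg (X : Type) (e : wseq X) : ord_le_omega :=
  match e with FinSeq s => Nat (size s) | OmegaSeq _ => Omega end.

Definition wrestr (X : Type) (al : ord_le_omega) (e : wseq X) : wseq X :=
  match al, e with
  | Nat n, FinSeq s => FinSeq (take n s)
  | Nat n, OmegaSeq f => FinSeq (mkseq f n)
  | Omega, _ => e
  end.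

(** Pointwise addition modulo 2; only used on sequences of the same length. *)
Definition wadd (e t : wseq bool) : wseq bool :=
  match e, t with
  | FinSeq s, FinSeq u => FinSeq [seq p.1 (+) p.2 | p <- zip s u]
  | OmegaSeq f, OmegaSeq g => OmegaSeq (fun n => f n (+) g n)
  | _, _ => t
  end.

Lemma lg_wrestr (X Y : Type) al (e : wseq X) (t : wseq Y) :
  lg e = lg t -> lg (wrestr al e) = lg (wrestr al t).
Proof.
case: al => [n|] //; case: e t => [s|f] [u|g] //= est.
- by case: est => est; rewrite !size_take est.
- by rewrite !size_mkseq.
Qed.

Lemma lg_wadd (e t : wseq bool) : lg e = lg t -> lg (wadd e t) = lg t.
Proof.
case: e t => [s|f] [u|g] //= est.
by case: est => est; rewrite size_map size_zip est minnn.
Qed.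

Section LadderStructure.
Context {d : Order.disp_t} {W : orderType d}.
Variables (S : set W) (nu : W -> nat -> W).

Definition wincreasing (e : wseq W) : Prop :=
  match e with
  | FinSeq s => sorted <%O s
  | OmegaSeq f => increasing f
  end.

Definition in_J0 (e : wseq W) : Prop :=
  wincreasing e /\ forall f, e = OmegaSeq f -> exists2 b, S b & f = nu b.

Definition J0 := {e : wseq W | in_J0 e}.

Record J := MkJ {
  fst_seq : J0;
  snd_seq : wseq bool;
  lg_seq : lg (sval fst_seq) = lg snd_seq }.

Lemma wincreasing_wrestr al e : wincreasing e -> wincreasing (wrestr al e).
Proof.
case: al e => [n|] // [s|f] //=.
- exact: take_sorted.
- move=> fS; rewrite /mkseq.
  apply: (@homo_sorted _ _ f ltn) (iota_ltn_sorted 0 n) => i j.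
  exact: fS.
Qed.

Lemma in_J0_wrestr al e : in_J0 e -> in_J0 (wrestr al e).
Proof.
move=> [einc enu]; split; first exact: wincreasing_wrestr.
by case: al e {einc} enu => [n|] // [s|f].
Qed.

Definition restr0 (al : ord_le_omega) (e : J0) : J0 :=
  exist _ _ (in_J0_wrestr al (svalP e)).

Definition restr (al : ord_le_omega) (t : J) : J :=
  @MkJ (restr0 al (fst_seq t)) (wrestr al (snd_seq t))
       (lg_wrestr al (lg_seq t)).

Lemma lg_translate (e t : J) : fst_seq e = fst_seq t ->
  lg (sval (fst_seq e)) = lg (wadd (snd_seq e) (snd_seq t)).
Proof. by move=> et; rewrite lg_wadd -!lg_seq et. Qed.

(** The interpretation of the function symbol attached to [e]: translation by
    the second component of [e] on U_(fst_seq e), the identity elsewhere. *)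
Definition translate (e t : J) : J :=
  match pselect (fst_seq e = fst_seq t) with
  | left et => MkJ (lg_translate et)
  | right _ => t
  end.

Inductive ladder_fsym := SymPi of ord_le_omega | SymBold of J.
Inductive ladder_rsym := SymU of J0.

Definition ladder_language : language :=
  {| fsym := ladder_fsym; farity := fun=> 1;
     rsym := ladder_rsym; rarity := fun=> 1 |}.

Definition ladder_structure : structure ladder_language :=
  @Structure ladder_language J
    (fun f => match f with
              | SymPi al => fun a : 'I_1 -> J => restr al (a ord0)
              | SymBold e => fun a : 'I_1 -> J => translate e (a ord0)
              end)
    (fun r => let: SymU e0 := r in
              fun a : 'I_1 -> J => fst_seq (a ord0) = e0).

End LadderStructure.

(* Main.v *)
Require Import Defs.
From mathcomp Require Import all_boot all_order.
From mathcomp Require Import boolp classical_sets functions cardinality wochoice.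

Set Implicit Arguments.
Unset Strict Implicit.
Unset Printing Implicit Defensive.

Local Open Scope classical_set_scope.

Import Order.TTheory.

(** Write A for the structure, U_e for the set of elements with first component
    e, and e|n for the restriction of e to n.  Every U_e is a torsor under
    2^(length of e), whose translations all have a name, and the projections
    commute with the translations.  Hence an automorphism of A moves each U_e by
    a translation, coherently along the tree J0, and such coherent families
    correspond to arbitrary boolean functions beta on the nonempty finite
    sequences of J0: the automorphism [flip beta] changes the n-th bit of an
    element over e when beta (e|(n+1)) holds ([flip_iso]).

    Atomicity.  For a tuple a, the formula [orbit_formula a] says over which e_i
    each entry lies and, for each pair of entries, by which named translation
    their projections to the meet of e_i and e_j differ.  A solution differs
    from a by bits that agree along common restrictions, so some flip carries a
    to it ([orbit_formula_defines]).  The formula thus defines the orbit of a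
    and isolates its type ([orbit_atomic]).

    Primeness.  Let N be a model of the theory of A.  Each U_e is nonempty in N,
    and over a finite e the named translations still act transitively on it, as
    this takes a finite disjunction.  This gives elements m(e) of U_e in N that
    the projections map to one another ([global_section]): for finite e they are
    chosen by recursion on the length; for infinite e, the projections of any
    element of U_e differ from the m(e|n) by the restrictions of one element u
    over e, and the translation by u corrects it.  The map that sends t over e
    to the image of m(e) under the translation by t is a homomorphism.  It
    preserves the orbit formulas, and a map that does is elementary
    ([orbit_elementary]).

    Uniqueness.  If N is atomic and y is in N, the types of y and of the pair
    (y, m(e)) are realised in A.  The first fact puts y in some U_e, the second
    makes y a named translate of m(e).  So the elementary map is onto
    ([section_map_onto]).

    Failure of constructibility.  Let a construction be given, and for b in S
    let t be its first element over nu b.  A formula that isolates the type of t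
    over the earlier elements has finitely many parameters, none of them over
    nu b, so they all leave nu b before some level k.  Flipping the last bit
    below that level, in the cone above (nu b)|k only, moves t and fixes the
    parameters; but an earlier element in this cone would fix that bit of t by a
    formula.  Hence there is none ([isolated_separated]), and t is the first
    element of the construction in this cone.  The finite sequence (nu b)|k
    therefore determines nu b, hence b.  So there is a function g from finite
    sequences to omega_1 such that every b in S is g(s) for some s with entries
    below b.  But the ordinals closed under g form a club, which meets S
    ([ladder_not_constructible]). *)

(** * Derived connectives *)

Section Connectives.
Variables (L : language) (n : nat).
Implicit Types p q : formula L n.

Definition Neg p := Imp p (Bot L n).
Definition And p q := Neg (Imp p (Neg q)).
Definition AllOf (I : finType) (F : I -> formula L n) :=
  foldr (fun i p => And (F i) p) (Neg (Bot L n)) (enum I).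
Definition SomeOf (I : finType) (F : I -> formula L n) :=
  Neg (AllOf (fun i => Neg (F i))).

Variables (M : structure L) (e : 'I_n -> M).

Lemma satisfies_And p q :
  satisfies (And p q) e <-> satisfies p e /\ satisfies q e.
Proof.
split=> [npq|[pe qe] npq]; last exact: npq.
by split; apply: contrapT => ne; apply: npq => pe.
Qed.

Lemma satisfies_AllOf (I : finType) (F : I -> formula L n) :
  satisfies (AllOf F) e <-> forall i, satisfies (F i) e.
Proof.
rewrite /AllOf; have memE i : i \in enum I by rewrite mem_enum.
suff H s : satisfies (foldr (fun i p => And (F i) p) (Neg (Bot L n)) s) e
    <-> forall i, i \in s -> satisfies (F i) e.
  by rewrite H; split=> [Fe i|Fe i _]; exact: Fe.
elim: s => [|i s IH]; first by split=> // _ [].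
rewrite [foldr _ _ _]/= satisfies_And IH; split=> [[Fi Fs] j|Fs].
  by rewrite inE => /orP[/eqP->//|]; exact: Fs.
by split=> [|j js]; apply: Fs; rewrite inE ?eqxx// js orbT.
Qed.

Lemma satisfies_SomeOf (I : finType) (F : I -> formula L n) :
  satisfies (SomeOf F) e <-> exists i, satisfies (F i) e.
Proof.
rewrite [satisfies _ _]/= satisfies_AllOf; split=> [nF|[i Fi] nF].
  by apply: contrapT => nex; apply: nF => i Fi; apply: nex; exists i.
exact: nF Fi.
Qed.

End Connectives.

Definition Ex (L : language) n (p : formula L n.+1) : formula L n :=
  Neg (All (Neg p)).

Lemma satisfies_Ex (L : language) n (p : formula L n.+1) (M : structure L)
    (e : 'I_n -> M) :
  satisfies (Ex p) e <-> exists x : M, satisfies p (env_cons x e).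
Proof.
split=> [nall|[x px] nall]; last exact: nall px.
by apply: contrapT => nex; apply: nall => x px; apply: nex; exists x.
Qed.

(** * Orbits, isolated types and elementary maps *)

Section ModelTheory.
Variable L : language.
Implicit Types M N : structure L.

Fixpoint closure n : formula L n -> sentence L :=
  match n return formula L n -> sentence L with
  | 0 => fun p => p
  | m.+1 => fun p => @closure m (All p)
  end.

Lemma env_cons0 T n x (e : 'I_n -> T) : env_cons x e ord0 = x.
Proof. by rewrite /env_cons unlift_none. Qed.

Lemma env_consS T n x (e : 'I_n -> T) i : env_cons x e (lift ord0 i) = e i.
Proof. by rewrite /env_cons liftK. Qed.

Lemma env_cons_eta T n (e : 'I_n.+1 -> T) :
  env_cons (e ord0) (fun i => e (lift ord0 i)) = e.
Proof.
apply: funext => i; rewrite /env_cons.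
by case: (unliftP ord0 i) => [j|] ->.
Qed.

Lemma holds_closure M n (p : formula L n) :
  holds M (closure p) <-> forall e : 'I_n -> M, satisfies p e.
Proof.
elim: n p => [|n IH] p /=.
  split=> [pM e|]; last exact.
  by rewrite (_ : e = @env0 M)//; apply: funext => -[].
rewrite IH; split=> [pM e|pM e x]; last exact: pM.
by rewrite -(env_cons_eta e); exact: pM.
Qed.

Lemma equiv_valid M N : elementarily_equivalent N M ->
  forall n (p : formula L n),
    (forall e : 'I_n -> M, satisfies p e) -> forall e : 'I_n -> N, satisfies p e.
Proof. by move=> NM n p pM; apply/holds_closure/NM/holds_closure. Qed.

Lemma equiv_sym M N :
  elementarily_equivalent N M -> elementarily_equivalent M N.
Proof. by move=> NM p; split=> /NM. Qed.

Lemma complete_theory M N :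
  is_model N (theory_of M) -> elementarily_equivalent N M.
Proof.
move=> NT p; split=> [pN|]; last exact: NT.
apply: contrapT => npM; exact: (NT (Neg p)).
Qed.

Lemma iso_elementary M N (h : M -> N) :
  isomorphism h -> elementary_embedding h.
Proof.
move=> [hbij hf hr]; have [g hK gK] := hbij.
have ht n (e : 'I_n -> M) (t : term L n) : h (teval e t) = teval (h \o e) t.
  elim: t => [//|f ts IH] /=; rewrite hf; congr fsem.
  by apply: funext => i /=; exact: IH.
move=> n p; elim: p => {n} [n|n t u|n r ts|n p IHp q IHq|n p IH] a /=.
- by [].
- by rewrite -!ht; split=> [->//|/(can_inj hK)].
- rewrite hr; suff -> : h \o (fun i => teval a (ts i))
    = (fun i => teval (h \o a) (ts i)) by [].
  by apply: funext => i /=; exact: ht.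
- by rewrite IHp IHq.
have hcons x : h \o env_cons x a = env_cons (h x) (h \o a).
  by apply: funext => i; rewrite /env_cons /=; case: (unlift _ _).
split=> [pa y|pa x]; last by rewrite IH hcons.
by rewrite -(gK y) -hcons -IH.
Qed.

Lemma isomorphic_sym M N : isomorphic M N -> isomorphic N M.
Proof.
move=> [h [[g hK gK] hf hr]]; exists g; split; first by exists h.
- move=> f a; apply: (can_inj hK); rewrite gK hf; congr fsem.
  by apply: funext => i /=; rewrite gK.
- move=> r a; rewrite hr; suff -> : h \o (g \o a) = a by [].
  by apply: funext => i /=; rewrite gK.
Qed.

Lemma elementary_surj_iso M N (h : M -> N) :
  elementary_embedding h -> (forall y, exists x, h x = y) -> isomorphism h.
Proof.
move=> hel hsurj; have [g gK] := choice hsurj.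
have hinj : injective h.
  move=> x y hxy.
  pose a (i : 'I_2) := if i == ord0 then x else y.
  apply/(hel 2 (Eq (Var L ord0) (Var L ord_max)) a).
  exact: hxy.
split.
- by exists g => // x; apply: hinj; rewrite gK.
- move=> f a; symmetry.
  have := hel _ (Eq (Var L ord0) (App (fun i => Var L (lift ord0 i))))
    (env_cons (fsem a) a).
  rewrite /= !env_cons0.
  have -> : (fun i => env_cons (fsem a) a (lift ord0 i)) = a.
    by apply: funext => i; rewrite env_consS.
  have -> : (fun i => h (env_cons (fsem a) a (lift ord0 i))) = h \o a.
    by apply: funext => i; rewrite env_consS.
  by move=> [H _]; rewrite H.
- by move=> r a; exact: (hel _ (Rel (fun i => Var L i)) a).
Qed.

Definition defines_orbit M n (p : formula L n) (a : 'I_n -> M) : Prop :=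
  satisfies p a /\
  forall x, satisfies p x -> exists2 s : M -> M, isomorphism s & s \o a = x.

Lemma automorphism_psatisfies M (A : set M) (s : M -> M) n
    (p : pformula A n) (a : 'I_n -> M) :
  isomorphism s -> s \o pparam (p:=p) = pparam (p:=p) ->
  psatisfies p a <-> psatisfies p (s \o a).
Proof.
move=> /iso_elementary sE sp; rewrite /psatisfies sE.
suff -> : s \o env_cat a (pparam (p:=p)) = env_cat (s \o a) (pparam (p:=p)).
  by [].
apply: funext => i; rewrite /env_cat /=; case: fintype.split => // j.
by have := congr1 (@^~ j) sp.
Qed.

Lemma env_cat_lshift T n m (a : 'I_n -> T) (b : 'I_m -> T) i :
  env_cat a b (lshift m i) = a i.
Proof. by rewrite /env_cat -[lshift m i]/(unsplit (inl i)) unsplitK. Qed.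

Lemma env_cat_rshift T n m (a : 'I_n -> T) (b : 'I_m -> T) i :
  env_cat a b (rshift n i) = b i.
Proof. by rewrite /env_cat -[rshift n i]/(unsplit (inr i)) unsplitK. Qed.

Lemma env_cat_set0 M n k (b : 'I_k -> M) (e : 'I_(n + k) -> M) :
  (forall i, (@set0 M) (b i)) -> env_cat (fun i => e (lshift k i)) b = e.
Proof.
move=> b0; apply: funext => i; rewrite /env_cat.
by rewrite -{2}(splitK i); case: fintype.split => [j|j] //=; case: (b0 j).
Qed.

(** An automorphism that carries [a] to [x] preserves all formulas, so a formula
    that defines the orbit of [a] implies every formula true of [a]. *)
Lemma orbit_atomic M :
  (forall n (a : 'I_n -> M), exists p, defines_orbit p a) -> atomic M.
Proof.
move=> orb n a.
have [p [pa porb]] := orb (n + 0) (env_cat a (@env0 M)).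
have P0 (i : 'I_0) : set0 (@env0 M i) by case: i.
exists (@PFormula L M set0 n 0 p (@env0 M) P0).
split=> // q qa x /porb[s s_iso sax].
suff <- : s \o a = x.
  apply/(automorphism_psatisfies a s_iso) => //.
  by apply: funext => i; case: (@pparamP _ _ _ _ q i).
apply: funext => i; have := congr1 (@^~ (lshift 0 i)) sax.
by rewrite /= !env_cat_lshift.
Qed.

(** The sentence saying that [p] implies [r] holds in [M] whenever [p] defines
    the orbit of [a] and [r] is true of [a]; it passes to [N]. *)
Lemma orbit_elementary M N (h : M -> N) : elementarily_equivalent N M ->
  (forall n (a : 'I_n -> M),
    exists2 p, defines_orbit p a & satisfies p (h \o a)) ->
  elementary_embedding h.
Proof.
move=> NM orb n q a; have [p [pa porb] pha] := orb n a.
have up r : satisfies r a -> satisfies r (h \o a).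
  move=> ra; apply: (equiv_valid NM (p := Imp p r)) pha => x /= /porb[s siso <-].
  by rewrite -(iso_elementary siso).
split=> [|qha]; first exact: up.
by apply: contrapT => nqa; exact: (up (Neg q)).
Qed.

(** The isolating formula is satisfiable in [N], hence in [M], and the sentences
    saying that it implies the members of the type pass from [N] to [M].  The
    parameters, of number [k], come from the empty set, so [k] is 0; it is
    kept to avoid a cast from [n + k] to [n]. *)
Lemma isolated_realized M N n (a : 'I_n -> N) : elementarily_equivalent N M ->
  isolated (tp (A := set0) a) ->
  exists k (eN : 'I_(n + k) -> N) (eM : 'I_(n + k) -> M),
    (forall i, eN (lshift k i) = a i) /\
    forall q, satisfies q eM <-> satisfies q eN.
Proof.
move=> NM [[k p b b0] []]; rewrite /tp /psatisfies /= => pa piso.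
have [eM peM] : exists eM : 'I_(n + k) -> M, satisfies p eM.
  apply: contrapT => nex.
  apply: (equiv_valid NM (p := Neg p) _ _ pa) => e /= pe.
  by apply: nex; exists e.
exists k, (env_cat a b), eM; split=> [i|q]; first by rewrite env_cat_lshift.
have down r : satisfies r (env_cat a b) -> satisfies r eM.
  move=> ra; apply: (equiv_valid (equiv_sym NM) (p := Imp p r)) peM => e /= pe.
  have := piso (PFormula r b0) ra (fun i => e (lshift k i)).
  by rewrite /psatisfies /= env_cat_set0// => /(_ pe).
split; last exact: down.
by move=> qM; apply: contrapT => nq; exact: (down (Neg q)).
Qed.

End ModelTheory.
(** * Elements of the structure as sequences of bits *)

Section Bits.

Definition below (al : ord_le_omega) n := if al is Nat m then n < m else true.

Definition wbit (w : wseq bool) n :=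
  match w with FinSeq s => nth false s n | OmegaSeq f => f n end.

Definition of_bits (al : ord_le_omega) (b : nat -> bool) : wseq bool :=
  if al is Nat n then FinSeq (mkseq b n) else OmegaSeq b.

Lemma lg_of_bits al b : lg (of_bits al b) = al.
Proof. by case: al => //= n; rewrite size_mkseq. Qed.

Lemma wbit_of_bits al b n : wbit (of_bits al b) n = below al n && b n.
Proof.
case: al => //= m; have [nm|mn] := ltnP n m; first by rewrite nth_mkseq.
by rewrite nth_default// size_mkseq.
Qed.

Lemma wbit_below w n : wbit w n = below (lg w) n && wbit w n.
Proof.
case: w => //= s; have [//|sn] := ltnP n (size s).
by rewrite nth_default.
Qed.

Lemma wbit_inj u v : lg u = lg v -> wbit u =1 wbit v -> u = v.
Proof.
case: u v => [s|f] [t|g] //=; last by move=> _ fg; congr OmegaSeq; exact: funext.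
move=> [st] b; congr FinSeq.
by apply: (@eq_from_nth _ false) => // i _; exact: b.
Qed.

Lemma below_lg_wrestr (X : Type) al (w : wseq X) n :
  below (lg (wrestr al w)) n = below al n && below (lg w) n.
Proof.
case: al w => [m|] [s|f] //=; last by rewrite size_mkseq andbT.
by rewrite size_take_min leq_min.
Qed.

Lemma wbit_wrestr al w n : wbit (wrestr al w) n = below al n && wbit w n.
Proof.
case: al w => [m|] [s|f] //=; have [nm|mn] := ltnP n m.
- by rewrite nth_take.
- by rewrite nth_default// size_take_min geq_min mn.
- by rewrite nth_mkseq.
- by rewrite nth_default// size_mkseq.
Qed.

Lemma wbit_wadd u v n : lg u = lg v -> wbit (wadd u v) n = wbit u n (+) wbit v n.
Proof.
case: u v => [s|f] [t|g] //= [st].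
have [ns|sn] := ltnP n (size s); last first.
  by rewrite !nth_default// -?st// size_map size_zip st minnn -st.
rewrite (nth_map (false, false)) ?size_zip -?st ?minnn//.
by rewrite nth_zip.
Qed.

Lemma take_mkseq (X : Type) (f : nat -> X) n m :
  n <= m -> take n (mkseq f m) = mkseq f n.
Proof. by move=> nm; rewrite /mkseq -map_take take_iota (minn_idPl nm). Qed.

Lemma wrestr_wrestr (X : Type) n m (w : wseq X) : n <= m ->
  wrestr (Nat n) (wrestr (Nat m) w) = wrestr (Nat n) w.
Proof.
by move=> nm; case: w => [s|f] /=; rewrite ?take_mkseq// take_takel.
Qed.

Lemma wrestr_wrestr_below (X : Type) al n (w : wseq X) : below al n ->
  wrestr (Nat n.+1) (wrestr al w) = wrestr (Nat n.+1) w.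
Proof. by case: al => [m|//] nm; exact: wrestr_wrestr. Qed.

End Bits.

(** An element of [J] is determined by its first component and its bits, which
    turns the algebra of translations and projections into that of booleans. *)
Section Tree.
Context {d : Order.disp_t} {W : orderType d} (S : set W) (nu : W -> nat -> W).

Local Notation J0 := (J0 S nu).
Local Notation J := (J S nu).
Implicit Types (e : J0) (t u : J).

Lemma J0_inj e e' : sval e = sval e' -> e = e'.
Proof. by case: e e' => [x p] [y q] /= xy; exact: eq_exist. Qed.

Definition bit t := wbit (snd_seq t).

Definition with_bits e (b : nat -> bool) : J :=
  MkJ (esym (lg_of_bits (lg (sval e)) b)).

Lemma bit_with_bits e b n :
  bit (with_bits e b) n = below (lg (sval e)) n && b n.
Proof. exact: wbit_of_bits. Qed.

Lemma bit_below t n : bit t n = below (lg (sval (fst_seq t))) n && bit t n.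
Proof. by rewrite lg_seq; exact: wbit_below. Qed.

Lemma J_inj t u : fst_seq t = fst_seq u -> bit t =1 bit u -> t = u.
Proof.
case: t u => [e b eb] [e' b' eb']; rewrite /bit /= => ee'; subst e' => bb'.
have ? : b = b' by apply: wbit_inj; rewrite // -eb.
by subst b'; congr MkJ.
Qed.

Lemma bit_restr al t n : bit (restr al t) n = below al n && bit t n.
Proof. exact: wbit_wrestr. Qed.

Lemma fst_translate u t : fst_seq (translate u t) = fst_seq t.
Proof. by rewrite /translate; case: pselect. Qed.

Lemma bit_translate u t n : fst_seq u = fst_seq t ->
  bit (translate u t) n = bit u n (+) bit t n.
Proof.
rewrite /translate; case: pselect => // ut _.
by rewrite /bit /= wbit_wadd// -!lg_seq ut.
Qed.

Lemma translate_out u t : fst_seq u <> fst_seq t -> translate u t = t.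
Proof. by rewrite /translate; case: pselect. Qed.

Lemma translateK u t : fst_seq u = fst_seq t ->
  translate (translate u t) t = u.
Proof.
move=> ut; apply: J_inj => [|n]; rewrite ?fst_translate//.
by rewrite !bit_translate// ?fst_translate// -addbA addbb addbF.
Qed.

Lemma restr_restr0 e n m : n <= m ->
  restr0 (Nat n) (restr0 (Nat m) e) = restr0 (Nat n) e.
Proof. by move=> nm; apply: J0_inj; exact: wrestr_wrestr. Qed.

Lemma restr_translate al u t : fst_seq u = fst_seq t ->
  restr al (translate u t) = translate (restr al u) (restr al t).
Proof.
move=> ut; have rut : fst_seq (restr al u) = fst_seq (restr al t) by rewrite /= ut.
apply: J_inj => [|n]; first by rewrite fst_translate /= fst_translate.
by rewrite bit_translate// !bit_restr bit_translate//; case: below.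
Qed.

(** * Automorphisms and atomicity *)

(** Since the change of bit [n] depends only on the restriction to [n.+1], it is
    compatible with all restrictions, whatever [b] is. *)
Definition flip (b : J0 -> bool) t : J :=
  with_bits (fst_seq t) (fun n => bit t n (+) b (restr0 (Nat n.+1) (fst_seq t))).

Lemma bit_flip b t n : bit (flip b t) n =
  bit t n (+)
    (below (lg (sval (fst_seq t))) n && b (restr0 (Nat n.+1) (fst_seq t))).
Proof.
rewrite bit_with_bits [in RHS]bit_below; by case: below.
Qed.

Lemma restr_flip b al t : restr al (flip b t) = flip b (restr al t).
Proof.
apply: J_inj => [//|n].
rewrite bit_restr !bit_flip bit_restr below_lg_wrestr.
have [aln|] := boolP (below al n); last by [].
by congr (_ (+) (_ && b _)); apply: J0_inj; exact/esym/wrestr_wrestr_below.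
Qed.

Lemma flipK b : involutive (flip b).
Proof.
by move=> t; apply: J_inj => [//|n]; rewrite !bit_flip /= -addbA addbb addbF.
Qed.

Lemma translate_flip b u t : translate u (flip b t) = flip b (translate u t).
Proof.
have [ut|ut] := pselect (fst_seq u = fst_seq t); last by rewrite !translate_out.
apply: J_inj => [|n]; first by rewrite fst_translate /= fst_translate.
by rewrite bit_translate// !bit_flip bit_translate// fst_translate addbA.
Qed.

Local Notation A := (ladder_structure S nu).

Lemma flip_iso b : @isomorphism _ A A (flip b).
Proof.
split; first by exists (flip b); exact: flipK.
- case=> [al|u] a; first by rewrite /= restr_flip.
  by rewrite /= translate_flip.
- by case=> e a.
Qed.

(** [al] is the length of the longest common restriction, or [Omega] when the two
    sequences are equal. *)
Lemma meet_level e e' : exists2 al, restr0 al e = restr0 al e' &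
  forall n, restr0 (Nat n) e = restr0 (Nat n) e' ->
    forall i, i < n -> below al i.
Proof.
have [->|ee'] := pselect (e = e'); first by exists Omega.
have diff : exists n, `[< restr0 (Nat n) e <> restr0 (Nat n) e' >].
  apply: contrapT => nex; apply: ee'; apply: J0_inj.
  have eqr n : wrestr (Nat n) (sval e) = wrestr (Nat n) (sval e').
    suff : restr0 (Nat n) e = restr0 (Nat n) e' by move/(congr1 sval).
    by apply: contrapT => ne; apply: nex; exists n; exact/asboolP.
  move: eqr; case: (sval e) (sval e') => [s|f] [s'|f'] /= eqr.
  - have [] := eqr (maxn (size s) (size s')).
    by rewrite !take_oversize ?leq_maxl ?leq_maxr// => ->.
  - have [/(congr1 size)] := eqr (size s).+1.
    by rewrite size_mkseq take_oversize// => /eqP; rewrite ltn_eqF.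
  - have [/(congr1 size)] := eqr (size s').+1.
    by rewrite size_mkseq take_oversize// => /eqP; rewrite gtn_eqF.
  - congr OmegaSeq; apply: funext => n.
    have := congr1 (fun w => if w is FinSeq s then nth (f n) s n else f n)
      (eqr n.+1).
    by rewrite !nth_mkseq.
case: (ex_minnP diff) => k /asboolP kd kmin.
have agree n : restr0 (Nat n) e = restr0 (Nat n) e' -> n < k.
  move=> en; rewrite ltnNge; apply/negP => kn; apply: kd.
  by rewrite -(restr_restr0 _ kn) en restr_restr0.
have k0 : 0 < k.
  apply: agree; apply: J0_inj => /=.
  by case: (sval e) (sval e') => [s|f] [s'|f'] /=; rewrite ?take0.
exists (Nat k.-1) => [|n /agree nk i ni /=].
  apply: contrapT => ne; have := kmin k.-1.
  by rewrite leqNgt prednK// leqnn /=; move/(_ (asboolT ne)).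
by rewrite (leq_trans ni)// -ltnS prednK.
Qed.

Definition meet e e' := s2val (cid2 (meet_level e e')).

Lemma restr0_meet e e' : restr0 (meet e e') e = restr0 (meet e e') e'.
Proof. exact: s2valP (cid2 (meet_level e e')). Qed.

Lemma below_meet e e' n : restr0 (Nat n.+1) e = restr0 (Nat n.+1) e' ->
  below (meet e e') n.
Proof. by move=> en; exact: (s2valP' (cid2 (meet_level e e')) _ en n). Qed.

Local Notation Lang := (ladder_language S nu).

Definition piT n al (x : term Lang n) : term Lang n :=
  @App Lang n (SymPi S nu al) (fun=> x).
Definition boldT n u (x : term Lang n) : term Lang n :=
  @App Lang n (SymBold u) (fun=> x).
Definition inU n e (x : term Lang n) : formula Lang n :=
  @Rel Lang n (SymU e) (fun=> x).

(** One level for each pair suffices: the relation between the two projections at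
    the meet implies the relations at all lower common restrictions. *)
Definition orbit_formula n (a : 'I_n -> J) : formula Lang n :=
  AllOf (fun ij : 'I_n * 'I_n =>
    let: (i, j) := ij in
    let al := meet (fst_seq (a i)) (fst_seq (a j)) in
    And (inU (fst_seq (a i)) (Var Lang i))
      (Eq (piT al (Var Lang i))
        (boldT (translate (restr al (a i)) (restr al (a j)))
           (piT al (Var Lang j))))).

Lemma lg_wrestr_below (X : Type) (w : wseq X) n :
  below (lg w) n -> lg (wrestr (Nat n.+1) w) = Nat n.+1.
Proof.
case: w => [s|f] ns; congr Nat; last by rewrite size_mkseq.
by rewrite size_takel.
Qed.

Lemma orbit_formula_defines n (a : 'I_n -> A) :
  defines_orbit (orbit_formula a) a.
Proof.
split=> [|x /satisfies_AllOf xa].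
  apply/satisfies_AllOf => -[i j]; apply/satisfies_And; split=> //=.
  by rewrite translateK//=; exact: restr0_meet.
have fx i : fst_seq (x i) = fst_seq (a i).
  by have /satisfies_And[] := xa (i, i).
have same i j k :
    restr0 (Nat k.+1) (fst_seq (a i)) = restr0 (Nat k.+1) (fst_seq (a j)) ->
    bit (a i) k (+) bit (x i) k = bit (a j) k (+) bit (x j) k.
  move=> /below_meet kal; have /satisfies_And[_] /= := xa (i, j).
  set al := meet _ _ in kal *; move/(congr1 (bit ^~ k)) => /=.
  have eij := restr0_meet (fst_seq (a i)) (fst_seq (a j)).
  rewrite bit_translate ?fst_translate/= ?fx//.
  rewrite bit_translate// !bit_restr kal /= => ->.
  by rewrite !addbA addbb.
(* By [same], the bit in which [a i] and [x i] differ at [k] depends only on the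
   restriction to [k.+1], so it can be prescribed on the tree. *)
pose b e := `[< exists i k, [/\ e = restr0 (Nat k.+1) (fst_seq (a i)),
  lg (sval e) = Nat k.+1 & bit (a i) k (+) bit (x i) k] >].
exists (flip b); first exact: flip_iso.
apply: funext => i; apply: J_inj => [|k]; first by rewrite fx.
rewrite /= bit_flip.
have [kl|kl] := boolP (below (lg (sval (fst_seq (a i)))) k); last first.
  by rewrite [LHS]addbF (bit_below (a i)) (bit_below (x i)) fx (negbTE kl).
have -> : b (restr0 (Nat k.+1) (fst_seq (a i))) = bit (a i) k (+) bit (x i) k.
  apply/asboolP/idP => [[j [k' [ek]]]|axk].
    rewrite lg_wrestr_below// => -[kk']; rewrite -kk' in ek *.
    by rewrite (same i j).
  by exists i, k; split=> //; rewrite lg_wrestr_below.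
by rewrite addbA addbb.
Qed.

Lemma ladder_atomic : atomic A.
Proof.
apply: orbit_atomic => n a.
by exists (orbit_formula a); exact: orbit_formula_defines.
Qed.

(** * Models of the theory of the ladder structure *)

Section EquivalentModel.
Variables (N : structure Lang) (NA : elementarily_equivalent N A).
Implicit Types x y z : N.

Definition inN e x : Prop := @rsem Lang N (SymU e) (fun=> x).
Definition piN al x : N := @fsem Lang N (SymPi S nu al) (fun=> x).
Definition boldN u x : N := @fsem Lang N (SymBold u) (fun=> x).

Let v0 : term Lang 1 := Var Lang ord0.

Lemma env1 (T : Type) (a : 'I_1 -> T) : a = fun=> a ord0.
Proof. by apply: funext => i; rewrite (ord1 i). Qed.

Lemma transfer1 e (p : formula Lang 1) :
  (forall t : A, fst_seq t = e -> satisfies p (fun=> t)) ->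
  forall x, inN e x -> satisfies p (fun=> x).
Proof.
move=> pA x xe; apply: (equiv_valid NA (p := Imp (inU e v0) p)) xe => a /=.
by rewrite (env1 a); exact: pA.
Qed.

Lemma nonempty_inN e : exists x, inN e x.
Proof.
have vA (a : 'I_0 -> A) : satisfies (Ex (inU e (Var Lang ord0))) a.
  by apply/satisfies_Ex; exists (with_bits e xpred0); rewrite /= env_cons0.
have /satisfies_Ex[x] := equiv_valid NA vA (@env0 N).
by rewrite /= env_cons0 => xe; exists x.
Qed.

Lemma inN_pi e al x : inN e x -> inN (restr0 al e) (piN al x).
Proof.
exact: (transfer1 (p := inU (restr0 al e) (piT al v0)) (fun t te => congr1 _ te)).
Qed.

Lemma inN_bold e u x : inN e x -> inN e (boldN u x).
Proof.
apply: (transfer1 (p := inU e (boldT u v0))) => t te.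
by rewrite /= fst_translate.
Qed.

Lemma pi_bold u al x : inN (fst_seq u) x ->
  piN al (boldN u x) = boldN (restr al u) (piN al x).
Proof.
apply: (transfer1 (p := Eq (piT al (boldT u v0)) (boldT (restr al u) (piT al v0)))).
by move=> t tu; exact: restr_translate.
Qed.

Lemma translateA u v t : fst_seq t = fst_seq v ->
  translate u (translate v t) = translate (translate u v) t.
Proof.
move=> tv; have [uv|uv] := pselect (fst_seq u = fst_seq v); last first.
  by rewrite (translate_out uv) translate_out// fst_translate tv.
apply: J_inj => [|n]; first by rewrite !fst_translate.
by rewrite !bit_translate ?fst_translate ?tv// addbA.
Qed.

Lemma bold_bold u v x : inN (fst_seq v) x ->
  boldN u (boldN v x) = boldN (translate u v) x.
Proof.
apply: (transfer1 (p := Eq (boldT u (boldT v v0)) (boldT (translate u v) v0))).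
by move=> t tv; exact: translateA.
Qed.

Lemma bold_involutive u x : inN (fst_seq u) x -> boldN u (boldN u x) = x.
Proof.
apply: (transfer1 (p := Eq (boldT u (boldT u v0)) v0)) => t tu.
apply: J_inj => [|n]; first by rewrite !fst_translate.
by rewrite !bit_translate ?fst_translate// addbA addbb.
Qed.

Lemma pi_pi e n m x : inN e x -> n <= m ->
  piN (Nat n) (piN (Nat m) x) = piN (Nat n) x.
Proof.
pose p := Eq (piT (Nat n) (piT (Nat m) v0)) (piT (Nat n) v0).
move=> + nm; apply: (transfer1 (p := p)).
move=> t _; apply: J_inj => [|i]; first exact: restr_restr0.
rewrite !bit_restr /=; have [/= ni|//] := ltnP i n.
by rewrite (leq_trans ni nm).
Qed.

Lemma pi_id e al x : restr0 al e = e -> inN e x -> piN al x = x.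
Proof.
move=> ae; apply: (transfer1 (p := Eq (piT al v0) v0)).
move=> t te; apply: J_inj => [|i]; first by rewrite /= te.
rewrite bit_restr bit_below te.
have := below_lg_wrestr al (sval e) i.
rewrite -[wrestr al (sval e)]/(sval (restr0 al e)) ae => ->.
by case: below.
Qed.

Lemma bold_free e u v x : fst_seq u = e -> fst_seq v = e -> inN e x ->
  boldN u x = boldN v x -> u = v.
Proof.
move=> ue ve xe uvx; apply: contrapT => uv; move: uvx.
apply: (transfer1 (p := Neg (Eq (boldT u v0) (boldT v v0)))) xe => t te /= utv.
apply: uv; apply: J_inj => [|n]; first by rewrite ue.
have := congr1 (bit ^~ n) utv; rewrite !bit_translate ?te//.
exact: addIb.
Qed.

(** This passes to [N] because there are finitely many translations over a finite
    sequence; over an infinite one it may fail in [N]. *)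
Lemma bold_transitive e n x y : lg (sval e) = Nat n -> inN e x -> inN e y ->
  exists2 u, fst_seq u = e & x = boldN u y.
Proof.
move=> le xe ye.
pose u (b : n.-tuple bool) := with_bits e (nth false b).
pose w0 := Var Lang (ord0 : 'I_2); pose w1 := Var Lang (ord_max : 'I_2).
pose p := Imp (inU e w0) (Imp (inU e w1)
  (SomeOf (fun b => Eq w0 (boldT (u b) w1)))).
have vA (a : 'I_2 -> A) : satisfies p a.
  move=> /= a0 a1; apply/(@satisfies_SomeOf _ _ A).
  pose b := [tuple bit (a ord0) i (+) bit (a ord_max) i | i < n]; exists b.
  apply: J_inj => [|i]; first by rewrite fst_translate/= a0.
  rewrite bit_translate/= ?a1// bit_with_bits le (bit_below (a ord0)) a0 le.
  case: (ltnP i n) => [ni|ni] /=; last first.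
    by rewrite (bit_below (a ord_max)) a1 le /= ltnNge ni.
  rewrite -[nth _ _ _](tnth_nth false b (Ordinal ni)) tnth_mktuple.
  by rewrite ni /= -addbA addbb addbF.
pose a (i : 'I_2) := if i == ord0 then x else y.
have := equiv_valid NA vA a xe ye.
by move/satisfies_SomeOf => [b ?]; exists (u b).
Qed.

Lemma inN_extend e al y : inN (restr0 al e) y -> exists2 z, inN e z & piN al z = y.
Proof.
move=> ye.
pose p : formula Lang 2 := And (inU e (Var Lang ord0))
  (Eq (piT al (Var Lang ord0)) (Var Lang (lift ord0 (ord0 : 'I_1)))).
have /satisfies_Ex[z /satisfies_And[]] : satisfies (Ex p) (fun=> y); last first.
  by rewrite /= env_cons0 env_consS => ze zy; exists z.
apply: transfer1 ye => t te; apply/satisfies_Ex; exists (with_bits e (bit t)).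
apply/satisfies_And; rewrite /= env_cons0 env_consS; split=> //.
apply: J_inj => [|i]; first by rewrite te.
by rewrite bit_restr bit_with_bits [RHS]bit_below te below_lg_wrestr andbA.
Qed.

Lemma sorted_J0 s : sorted <%O s -> exists e, sval e = FinSeq s.
Proof.
move=> ss; suff sJ : in_J0 S nu (FinSeq s) by exists (exist _ _ sJ).
by split.
Qed.

(** Recursion on the length, lifting the element chosen over [s] to one over
    [rcons s x]. *)
Lemma finite_section : exists m : seq W -> N,
  forall e s, sval e = FinSeq s ->
    inN e (m s) /\ forall n, piN (Nat n) (m s) = m (take n s).
Proof.
have step (q : seq W * W * N) : exists z, forall e e',
    sval e = FinSeq q.1.1 -> sval e' = FinSeq (rcons q.1.1 q.1.2) ->
    inN e q.2 -> inN e' z /\ piN (Nat (size q.1.1)) z = q.2.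
  case: q => [[s x] y] /=.
  have [[e' es]|nsx] := pselect (exists e', sval e' = FinSeq (rcons s x));
    last by exists y => e e' _ e's; case: nsx; exists e'.
  have rs : sval (restr0 (Nat (size s)) e') = FinSeq s.
    by rewrite /= es -cats1 /= take_size_cat.
  have [ye|nye] := pselect (inN (restr0 (Nat (size s)) e') y); last first.
    exists y => e e'' se _ ey; case: nye.
    by rewrite (_ : restr0 _ _ = e)//; apply: J0_inj; rewrite rs.
  have [z ze zy] := inN_extend ye; exists z => e e'' _ se' _; split=> //.
  by rewrite (_ : e'' = e')//; apply: J0_inj; rewrite es.
(* The recursion runs from left to right, so its state [q] carries the prefix
   read so far together with the element chosen over it. *)
have [f fP] := choice step.
have [e0 e0nil] := sorted_J0 (s := [::]) isT.
have [y0 y0e0] := nonempty_inN e0.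
pose g := foldl (fun (q : seq W * N) (x : W) => (rcons q.1 x, f (q.1, x, q.2)))
  ([::], y0).
have g1 s : (g s).1 = s.
  by elim/last_ind: s => //= s x IH; rewrite /g -cats1 foldl_cat /= -/g IH cats1.
have gS s (x : W) : (g (rcons s x)).2 = f (s, x, (g s).2).
  by rewrite {1}/g -cats1 foldl_cat /= -/g g1.
exists (fun s => (g s).2) => e s; elim/last_ind: s e => [|s x IH] e es.
  have -> : e = e0 by apply: J0_inj; rewrite es.
  split=> // n; rewrite (pi_id (e := e0))//.
  by apply: J0_inj; rewrite /= e0nil.
have es' : sval (restr0 (Nat (size s)) e) = FinSeq s.
  by rewrite /= es -cats1 /= take_size_cat.
have [gs gn] := IH _ es'.
have [ge gp] := fP (s, x, (g s).2) _ _ es' es gs.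
rewrite gS; split=> // n.
have [sn|ns] := ltnP (size s) n.
  rewrite take_oversize ?size_rcons// gS (pi_id (e := e))//.
  by apply: J0_inj; rewrite /= es /= take_oversize// size_rcons.
rewrite -(pi_pi ge ns) gp gn; congr (g _).2.
by rewrite -cats1 takel_cat.
Qed.

(** Over an infinite [e], an arbitrary element [x] of the fibre is corrected: its
    projections differ from the finite section by translations [u n], which are
    coherent because the action is free, and so have a common extension [v]. *)
Lemma global_section : exists m : J0 -> N,
  forall e, inN e (m e) /\ forall al, piN al (m e) = m (restr0 al e).
Proof.
have [m0 m0P] := finite_section.
have lim (f : nat -> W) : exists z, forall e, sval e = OmegaSeq f ->
    inN e z /\ forall n, piN (Nat n) z = m0 (mkseq f n).
  have [[e ef]|nef] := pselect (exists e, sval e = OmegaSeq f); last first.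
    by exists (m0 [::]) => e ef; case: nef; exists e.
  have [x xe] := nonempty_inN e.
  have rn n : sval (restr0 (Nat n) e) = FinSeq (mkseq f n) by rewrite /= ef.
  have dP n : exists u, fst_seq u = restr0 (Nat n) e /\
      piN (Nat n) x = boldN u (m0 (mkseq f n)).
    have [mn _] := m0P _ _ (rn n).
    have lgn : lg (sval (restr0 (Nat n) e)) = Nat n.
      by rewrite rn /= size_mkseq.
    have [u ue xu] := bold_transitive lgn (inN_pi (Nat n) xe) mn.
    by exists u.
  have [u uP] := choice dP.
  have uu n m : n <= m -> restr (Nat n) (u m) = u n.
    move=> nm; have [[un xn] [um xm]] := (uP n, uP m).
    have [mn mnn] := m0P _ _ (rn n); have [mm mmn] := m0P _ _ (rn m).
    apply: (bold_free (e := restr0 (Nat n) e)) mn _ => //.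
      by rewrite /= um restr_restr0.
    rewrite -xn -(pi_pi xe nm) xm pi_bold ?um// mmn.
    by rewrite take_mkseq.
  pose v := with_bits e (fun i => bit (u i.+1) i).
  have vn n : restr (Nat n) v = u n.
    apply: J_inj => [|i]; first by have [-> _] := uP n.
    rewrite bit_restr bit_with_bits ef /=.
    have [ni|ni] := ltnP i n.
      by rewrite -(uu _ _ ni) bit_restr /= ltnSn.
    have [un _] := uP n.
    by rewrite (bit_below (u n)) un rn /= size_mkseq ltnNge ni.
  exists (boldN v x) => e' ee'; have -> : e' = e by apply: J0_inj; rewrite ef.
  split=> [|n]; first exact: inN_bold.
  have [un xn] := uP n; have [mn _] := m0P _ _ (rn n).
  by rewrite pi_bold// vn xn bold_involutive ?un.
have [mo moP] := choice lim.
pose m e := match sval e with FinSeq s => m0 s | OmegaSeq f => mo f end.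
exists m => e; rewrite /m; case E: (sval e) => [s|f].
  have [ms msn] := m0P _ _ E; split=> // -[n|] /=; rewrite E//=.
  by rewrite (pi_id (e := e))//; apply: J0_inj.
have [ms msn] := moP _ _ E; split=> // -[n|] /=; rewrite E//=.
by rewrite (pi_id (e := e))//; apply: J0_inj.
Qed.

Section FromGlobalSection.
Variable m : J0 -> N.
Hypothesis mP : forall e, inN e (m e) /\ forall al, piN al (m e) = m (restr0 al e).

Definition section_map (t : A) : N := boldN t (m (fst_seq t)).

(** The orbit formulas are conjunctions of atomic formulas, so they are preserved
    by homomorphisms. *)
Lemma section_map_elementary : elementary_embedding section_map.
Proof.
apply: (orbit_elementary NA) => n a; exists (orbit_formula a).
  exact: orbit_formula_defines.
apply/satisfies_AllOf => -[i j]; apply/satisfies_And; split.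
  by apply: inN_bold; case: (mP (fst_seq (a i))).
have eij := restr0_meet (fst_seq (a i)) (fst_seq (a j)).
rewrite /= -!/(piN _ _) -!/(boldN _ _) /=; set al := meet _ _ in eij *.
have [mi mir] := mP (fst_seq (a i)); have [mj mjr] := mP (fst_seq (a j)).
rewrite /section_map !pi_bold// mir mjr.
rewrite bold_bold; last by case: (mP (restr0 al (fst_seq (a j)))).
by rewrite translateK// eij.
Qed.

(** The type of the pair of [y] and [m e] is realised by a pair in one fibre of
    the ladder structure, where a named translation relates the two elements. *)
Lemma section_map_onto : atomic N -> forall y, exists t, section_map t = y.
Proof.
move=> N_atomic y.
have [k [eN [eM [yE eq]]]] := isolated_realized NA (N_atomic 1 (fun=> y)).
set e := fst_seq (eM (lshift k ord0)).
have ye : inN e y.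
  have [H _] := eq (inU e (Var Lang (lshift k ord0))).
  by move: H; rewrite /= yE; exact.
pose a (i : 'I_2) := if i == ord0 then y else m e.
have [l [fN [fM [aE feq]]]] := isolated_realized NA (N_atomic 2 a).
have fMe i : inN e (a i) -> fst_seq (fM (lshift l i)) = e.
  move=> ie; have [_] := feq (inU e (Var Lang (lshift l i))).
  by rewrite /= aE; exact.
have [me _] := mP e.
pose s := fM (lshift l ord0); pose t := fM (lshift l ord_max).
have se : fst_seq s = e by exact: fMe.
have te : fst_seq t = e by exact: fMe.
pose p : formula Lang (2 + l) := Eq (Var Lang (lshift l ord0))
  (boldT (translate s t) (Var Lang (lshift l ord_max))).
have [pN _] := feq p; exists (translate s t).
rewrite /section_map fst_translate te; symmetry.
move: pN; rewrite /= !aE; apply.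
by rewrite translateK// se.
Qed.

End FromGlobalSection.

Lemma elementary_image : exists h : A -> N, elementary_embedding h.
Proof.
have [m mP] := global_section.
by exists (section_map m); exact: section_map_elementary.
Qed.

Lemma atomic_isomorphic : atomic N -> isomorphic N A.
Proof.
move=> N_atomic; have [m mP] := global_section; apply: isomorphic_sym.
exists (section_map m); apply: elementary_surj_iso.
  exact: section_map_elementary.
exact: section_map_onto.
Qed.

End EquivalentModel.
End Tree.

(** * Clubs in omega_1 *)

Lemma well_order_min (d : Order.disp_t) (I : orderType d) (P : I -> Prop) :
  well_order (<=%O : rel I) -> (exists x, P x) ->
  exists2 x, P x & forall y, P y -> (x <= y)%O.
Proof.
move=> wo [x Px]; have [|z [[/asboolP Pz zmin] _]] := wo [pred x | `[<P x>]].
  by exists x; exact/asboolP.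
by exists z => // y Py; apply: zmin; exact/asboolP.
Qed.

Lemma countableU T (A B : set T) :
  countable A -> countable B -> countable (A `|` B).
Proof.
move=> cA cB; rewrite -bigcup2E; apply: bigcup_countable => // -[|[|n]] _ //=.
Qed.

Lemma countable_image T U (f : T -> U) (A : set T) :
  countable A -> countable (f @` A).
Proof. exact/sub_countable/card_image_le. Qed.

Section Omega1.
Context {d : Order.disp_t} {W : orderType d} (W1 : is_omega1 W).
Implicit Types (a b c x : W) (X S C : set W).

Let wo : well_order (<=%O : rel W). Proof. by case: W1. Qed.

Lemma countable_le a : countable [set b | (b <= a)%O].
Proof.
have [_ _ /(_ a) cb] := W1.
apply: (@sub_countable _ _ _ ([set b | (b < a)%O] `|` [set a])).
  apply: subset_card_le => b /=; rewrite le_eqVlt.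
  by case/orP => [/eqP->|]; [right|left].
exact: countableU (countable1 _).
Qed.

Lemma countable_bounded X : countable X -> exists a, forall x, X x -> (x < a)%O.
Proof.
move=> cX; apply: contrapT => nb; have [_ W_unc _] := W1; apply: W_unc.
apply: (@sub_countable _ _ _ (\bigcup_(x in X) [set b | (b <= x)%O])).
  apply: subset_card_le => a _; apply: contrapT => na; apply: nb.
  exists a => x Xx; rewrite ltNge; apply/negP => ax.
  by apply: na; exists x.
by apply: bigcup_countable => // x _; exact: countable_le.
Qed.

Lemma countable_seqs X : countable X ->
  countable [set s : seq W | forall x, x \in s -> X x].
Proof.
move=> /countable_injP[f finj]; apply/countable_injP.
exists (fun s => choice.pickle (map f s)) => s t; rewrite !inE /= => sX tX.
move/(pcan_inj choice.pickleK).
elim: s t sX tX => [|x s IH] [|y t] //= sX tX [fxy fst].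
congr (_ :: _).
  by apply: finj => //; rewrite inE; [apply: sX|apply: tX]; rewrite mem_head.
by apply: IH => // z zs; [apply: sX|apply: tX]; rewrite inE zs orbT.
Qed.

Definition closed_under (g : seq W -> W) : set W :=
  [set c | forall s, (forall x, x \in s -> (x < c)%O) -> (g s < c)%O].

(** Above [a], iterate omega times a function [F] such that [F b] bounds the
    countably many values of [g] at sequences with entries at most [b], and take
    the supremum: a finite sequence below it is already below some iterate. *)
Lemma club_closed_under g : club (closed_under g).
Proof.
split=> [a [[b0 b0a] _] acof s sa|a].
  have [b ba sb] : exists2 b, (b < a)%O & forall x, x \in s -> (x <= b)%O.
    elim: s sa => [|x s IH] sa; first by exists b0.
    have [|b ba sb] := IH; first by move=> y ys; apply: sa; rewrite inE ys orbT.
    exists (Order.max x b).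
      by rewrite gt_max sa ?mem_head.
    move=> y; rewrite inE le_max => /orP[/eqP->|/sb->].
      by rewrite lexx.
    by rewrite orbT.
  have [c gc /andP[bc ca]] := acof b ba.
  apply: lt_trans ca; apply: gc => x /sb xb.
  exact: le_lt_trans bc.
have step b : exists c, (b < c)%O /\
    forall s, (forall x, x \in s -> (x <= b)%O) -> (g s < c)%O.
  have [] := @countable_bounded ([set b] `|`
    g @` [set s | forall x, x \in s -> [set y | (y <= b)%O] x]).
    apply: countableU; first exact: countable1.
    apply: countable_image; exact/countable_seqs/countable_le.
  move=> c cb; exists c; split=> [|s sb]; first by apply: cb; left.
  by apply: cb; right; exists s.
have [F FP] := choice step; pose b n := iter n F a.
have bS n : (b n < b n.+1)%O by case: (FP (b n)).
have bmono m n : m <= n -> (b m <= b n)%O.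
  elim: n => [|n IH]; first by rewrite leqn0 => /eqP->.
  rewrite leq_eqVlt => /orP[/eqP->//|/IH].
  by move/le_trans; apply; exact: ltW.
have [u ub] := @countable_bounded (range b) (countable_image _ (countableP _)).
have [|c bc cmin] := @well_order_min _ _ (fun c => forall n, (b n < c)%O) wo.
  by exists u => n; apply: ub; exists n.
exists c; last exact: (bc 0).
move=> s sc.
have [n sn] : exists n, forall x, x \in s -> (x <= b n)%O.
  elim: s sc => [|x s IH] sc; first by exists 0.
  have [|n sn] := IH; first by move=> y ys; apply: sc; rewrite inE ys orbT.
  have [k xk] : exists k, (x <= b k)%O.
    apply: contrapT => nk; have := sc x (mem_head _ _).
    rewrite ltNge cmin// => k.
    by rewrite ltNge; apply/negP => xk; apply: nk; exists k.
  exists (maxn k n) => y; rewrite inE => /orP[/eqP->|/sn yn].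
    by rewrite (le_trans xk)// bmono ?leq_maxl.
  by rewrite (le_trans yn)// bmono ?leq_maxr.
apply: lt_trans (bc n.+1).
by have [_] := FP (b n); apply.
Qed.

Lemma stationary_nonempty S : stationary S -> S !=set0.
Proof.
have [a _] := countable_bounded (countable0 W).
by move=> /(_ _ (club_closed_under (fun=> a))) [b [Sb _]]; exists b.
Qed.

(** * The size of the language *)

Definition codable (X : Type) := exists f : X -> nat -> bool, injective f.

(** By recursion, [f a] is chosen by diagonalisation away from the countably many
    [f b] with [b] below [a]. *)
Lemma omega1_codable : codable W.
Proof.
have wf : well_founded (fun a b => (a < b)%O).
  move=> a; apply: contrapT => na.
  have [x nx xmin] := @well_order_min _ _ (fun x => ~ Acc (fun a b => (a < b)%O) x)
    wo (ex_intro _ a na).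
  apply: nx; constructor=> y yx; apply: contrapT => /xmin.
  by rewrite leNgt yx.
have diag a (r : forall b, (b < a)%O -> nat -> bool) :
    exists y : nat -> bool, forall b (ba : (b < a)%O), y <> r b ba.
  have [_ _ /(_ a)/countable_injP[f finj]] := W1.
  exists (fun n => `[< forall b (ba : (b < a)%O), f b = n -> r b ba n = false >]).
  move=> b ba /(congr1 (@^~ (f b))).
  case E: (r b ba (f b)) => /asboolP; first by move=> /(_ b ba erefl); rewrite E.
  move=> H; apply: H => b' b'a fb.
  have bb : b' = b by apply: finj; rewrite ?inE.
  by subst b'; rewrite (Prop_irrelevance b'a ba).
pose F a r := sval (cid (diag a r)).
pose f := Fix wf (fun=> nat -> bool) F.
have fE a : f a = F a (fun b _ => f b).
  rewrite /f Fix_eq// => x g h gh; congr F.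
  by apply: functional_extensionality_dep => b; apply: funext.
exists f => a b fab; have fne x y : (x < y)%O -> f x <> f y.
  move=> xy /esym; rewrite fE.
  exact: (svalP (cid (diag y (fun b _ => f b))) x xy).
by case: (ltgtP a b) => // /fne => [/(_ fab)|/(_ (esym fab))].
Qed.

End Omega1.

Section Codable.
Local Open Scope card_scope.

Lemma codable_inj X Y (f : X -> Y) : injective f -> codable Y -> codable X.
Proof. by move=> finj [g ginj]; exists (g \o f); exact: inj_comp. Qed.

Lemma codable_countable (T : countType) : codable T.
Proof.
exists (fun x n => n == choice.pickle x) => x y /(congr1 (@^~ (choice.pickle x))).
rewrite eqxx => /esym/eqP; exact: (pcan_inj choice.pickleK).
Qed.

Lemma codable_sequences X : codable X -> codable (nat -> X).
Proof.
move=> [f finj].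
exists (fun u k => if choice.unpickle k is Some (i, j) then f (u i) j else false).
move=> u v uv; apply: funext => i; apply: finj; apply: funext => j.
by have := congr1 (@^~ (choice.pickle (i, j))) uv; rewrite choice.pickleK.
Qed.

Lemma codable_option X : codable X -> codable (option X).
Proof.
move=> [f finj].
exists (fun x n =>
  if x is Some y then (if n is m.+1 then f y m else true) else false).
move=> [x|] [y|] // xy; have := congr1 (@^~ 0) xy => // _.
congr Some; apply: finj; apply: funext => n.
exact: (congr1 (@^~ n.+1) xy).
Qed.

Lemma codable_prod X Y : codable X -> codable Y -> codable (X * Y).
Proof.
move=> [f finj] [g ginj].
have c2 : codable (nat -> nat -> bool) by apply: codable_sequences; exists id.
pose h (p : X * Y) (n : nat) := if n is 0 then f p.1 else g p.2.
apply: (codable_inj (f := h)) c2.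
move=> [x y] [x' y'] e; have /= /finj -> := congr1 (@^~ 0) e.
by have /= /ginj -> := congr1 (@^~ 1) e.
Qed.

Lemma codable_sum X Y : codable X -> codable Y -> codable (X + Y).
Proof.
move=> cX cY.
pose h (p : X + Y) :=
  match p with inl x => (Some x, None) | inr y => (None, Some y) end.
apply: (codable_inj (f := h));
  last exact: codable_prod (codable_option cX) (codable_option cY).
by move=> [x|y] [x'|y'] // [->].
Qed.

Lemma inj_card_leT X Y (f : X -> Y) : injective f -> [set: X] #<= [set: Y].
Proof.
move=> finj; have fin : {in [set: X] &, injective f} by move=> x y _ _ /finj.
have := inj_card_eq fin; rewrite card_eq_sym => /card_eqPle[Xf _].
by apply: card_le_trans Xf _; exact: subset_card_le.
Qed.

Lemma continuum_codable X (f : (nat -> bool) -> X) :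
  injective f -> codable X -> [set: X] #= [set: nat -> bool].
Proof.
move=> finj [g ginj]; apply/card_eqPle.
by split; apply: inj_card_leT; [exact: ginj|exact: finj].
Qed.

End Codable.

Section Size.
Context {d : Order.disp_t} {W : orderType d} (W1 : is_omega1 W).
Variables (S : set W) (nu : W -> nat -> W).
Local Notation Lang := (ladder_language S nu).

Lemma J0_codable : codable (J0 S nu).
Proof.
pose h (e : J0 S nu) (n : nat) := match sval e with
  FinSeq s => nth None (map Some s) n | OmegaSeq f => Some (f n) end.
apply: (codable_inj (f := h));
  last exact/codable_sequences/codable_option/omega1_codable.
move=> e e' ee'; apply: J0_inj; move: ee'; rewrite /h.
case: (sval e) (sval e') => [s|f] [s'|f'] ss'; have /= sE n := congr1 (@^~ n) ss'.
- congr FinSeq.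
  have sz (u v : seq W) :
      (forall n, nth None (map Some u) n = nth None (map Some v) n) ->
      size u <= size v.
    move=> /(_ (size v)); rewrite [X in _ = X]nth_default ?size_map//.
    case: (leqP (size u) (size v)) => // vu.
    by case: u vu => // x u vu; rewrite (nth_map x).
  have /eqP ss : size s == size s' by rewrite eqn_leq !sz// => n; rewrite sE.
  apply: (inj_map (f := Some)); first by move=> ? ? [].
  apply: (@eq_from_nth _ None); rewrite ?size_map// => n _; exact: sE.
- by have := sE (size s); rewrite nth_default// size_map.
- by have := sE (size s'); rewrite nth_default// size_map.
- by congr OmegaSeq; apply: funext => n; have [] := sE n.
Qed.

Lemma J_codable : codable (J S nu).
Proof.
have cB : codable (nat -> bool) by exists id.
apply: (codable_inj (f := fun t => (fst_seq t, bit t)));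
  last exact: codable_prod J0_codable cB.
by move=> t u [tu bb]; apply: J_inj => // n; rewrite bb.
Qed.

Lemma symbols_codable : codable (symbols Lang).
Proof.
pose h (s : symbols Lang) : option nat + J S nu + J0 S nu :=
  match s with
  | inl (SymPi (Nat n)) => inl (inl (Some n))
  | inl (SymPi Omega) => inl (inl None)
  | inl (SymBold u) => inl (inr u)
  | inr (SymU e) => inr e
  end.
apply: (codable_inj (f := h)); last first.
  apply: codable_sum J0_codable; apply: codable_sum J_codable.
  exact/codable_option/codable_countable.
by move=> [[[m|]|u]|[e]] [[[m'|]|u']|[e']] //= [->].
Qed.

Lemma ladder_language_size (e : J0 S nu) :
  lg (sval e) = Omega -> has_size_continuum Lang.
Proof.
move=> eO; pose h b : symbols Lang := inl (@SymBold _ _ S nu (with_bits e b)).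
apply: (continuum_codable (f := h)); last exact: symbols_codable.
move=> b b' [bb]; apply: funext => n.
have := congr1 (@^~ n) (congr1 wbit bb).
by rewrite !wbit_of_bits eO.
Qed.

End Size.

(** * Failure of constructibility *)

Section NotConstructible.
Context {d : Order.disp_t} {W : orderType d}.
Variables (S : set W) (nu : W -> nat -> W).
Local Notation J0 := (J0 S nu).
Local Notation A := (ladder_structure S nu).
Local Notation Lang := (ladder_language S nu).
Implicit Types (e : J0) (t : A).

Lemma separated e e' : e <> e' ->
  exists k, restr0 (Nat k.+1) e <> restr0 (Nat k.+1) e'.
Proof.
move=> ee'; have := restr0_meet e e'; have := @below_meet _ _ _ _ e e'.
case: (meet e e') => [k|] kn rk; last first.
  by case: ee'; apply: J0_inj; exact: (congr1 sval rk).
by exists k => /kn; rewrite /= ltnn.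
Qed.

(** For [K.+1] beyond the meets with the finitely many parameters of the isolating
    formula, flipping bit [K] in the cone above the restriction of [t] to [K.+1]
    fixes these parameters, so the isolating formula still holds of the flipped
    [t].  But an element [b] of [B] in this cone would fix the restriction of [t]
    to [K.+1] by a formula with parameter [b]. *)
Lemma isolated_separated (B : set A) t :
  lg (sval (fst_seq t)) = Omega -> (forall b, B b -> fst_seq b <> fst_seq t) ->
  isolated (tp (A := B) (fun _ : 'I_1 => t)) ->
  exists k, forall b, B b ->
    restr0 (Nat k) (fst_seq b) <> restr0 (Nat k) (fst_seq t).
Proof.
set e := fst_seq t => eO Be [p [pt piso]].
have sepp j : exists k, restr0 (Nat k.+1) (fst_seq (pparam (p:=p) j)) <>
    restr0 (Nat k.+1) e.
  by apply: separated; apply: Be; exact: pparamP.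
have [k kP] := choice sepp; pose K := \max_j k j.
have KP j : restr0 (Nat K.+1) (fst_seq (pparam (p:=p) j)) <> restr0 (Nat K.+1) e.
  move=> jK; apply: (kP j).
  have jk : k j < K.+1 by rewrite ltnS; exact: leq_bigmax.
  by rewrite -(restr_restr0 _ jk) jK restr_restr0.
exists K.+1 => b Bb bK.
pose s : A -> A := flip (fun e' => `[< e' = restr0 (Nat K.+1) e >]).
have s_iso : @isomorphism _ A A s by exact: flip_iso.
have sp : s \o pparam (p:=p) = pparam (p:=p).
  apply: funext => j; apply: J_inj => [//|n]; rewrite bit_flip.
  have [nl|_] := boolP (below _ n); last by rewrite addbF.
  case: asboolP => [E|_]; last by rewrite addbF.
  have := congr1 (lg (X := W) \o sval) E.
  rewrite /= !lg_wrestr_below// ?eO// => -[nK].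
  by case: (KP j); rewrite -nK in E *.
have pst : psatisfies p (s \o (fun _ : 'I_1 => t)).
  exact: (proj1 (automorphism_psatisfies _ s_iso sp) pt).
pose u : J S nu := translate (restr (Nat K.+1) t) (restr (Nat K.+1) b).
pose f : formula Lang (1 + 1) := Eq (piT (Nat K.+1) (Var Lang (lshift 1 ord0)))
  (boldT u (piT (Nat K.+1) (Var Lang (rshift 1 ord0)))).
pose q := PFormula f (fun _ : 'I_1 => Bb).
have qE (x : 'I_1 -> A) : psatisfies q x <->
    restr (Nat K.+1) (x ord0) = restr (Nat K.+1) t.
  rewrite /psatisfies /= env_cat_lshift env_cat_rshift translateK//=.
have /qE : psatisfies q (s \o (fun _ : 'I_1 => t)) by apply: piso => //; exact/qE.
move=> /(congr1 (fun v => bit v K)) /=.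
rewrite !bit_restr /= ltnSn /= bit_flip eO asboolT//=.
by case: bit.
Qed.

Variable L : W -> set W.
Hypotheses (W1 : is_omega1 W) (S_stat : stationary S).
Hypothesis (L_ladder : ladder_system S L).
Hypothesis (nu_enum : forall a, S a -> enumerates (nu a) (L a)).

Lemma J0_omega b : S b -> exists e, sval e = OmegaSeq (nu b).
Proof.
move=> Sb; suff bJ : in_J0 S nu (OmegaSeq (nu b)) by exists (exist _ _ bJ).
by split=> [|f [<-]]; [case: (nu_enum Sb) | exists b].
Qed.

Lemma nu_lt b n : S b -> (nu b n < b)%O.
Proof.
move=> Sb; have [Lb _ _] := L_ladder Sb; apply: Lb.
by have [_ <-] := nu_enum Sb; exists n.
Qed.

Lemma nu_inj b c : S b -> S c -> nu b = nu c -> b = c.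
Proof.
have nlt x y : S x -> S y -> nu x = nu y -> ~ (x < y)%O.
  move=> Sx Sy xy; have [_ cof _] := L_ladder Sy => /cof[z].
  have [_ <-] := nu_enum Sy => -[n _ <-]; rewrite -xy => /andP[xn _].
  by have := lt_trans xn (nu_lt n Sx); rewrite ltxx.
move=> Sb Sc bc; case: (ltgtP b c) => // bc'.
  by case: (nlt _ _ Sb Sc bc).
by case: (nlt _ _ Sc Sb (esym bc)).
Qed.

(** [codes s b] says that the first element of the construction whose first
    component extends [s] lies over [nu b]; every [b] in [S] has a code with
    entries below [b]. *)
Lemma ladder_not_constructible : ~ constructible A.
Proof.
move=> [dI [I [a [wo surj iso]]]].
pose above (s : seq W) i := sval (restr0 (Nat (size s)) (fst_seq (a i))) = FinSeq s.
pose codes s b := S b /\ exists i, [/\ above s i, forall j, above s j -> (i <= j)%O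
  & sval (fst_seq (a i)) = OmegaSeq (nu b)].
have codes_fun s b c : codes s b -> codes s c -> b = c.
  move=> [Sb [i [si imin ib]]] [Sc [j [sj jmin jc]]].
  have ij : i = j by apply/le_anti; rewrite imin// jmin.
  by subst j; apply: nu_inj => //; move: jc; rewrite ib => -[].
have [w0 Sw0] := stationary_nonempty W1 S_stat.
have ex_g s : exists c, forall b, codes s b -> b = c.
  have [[b sb]|ns] := pselect (exists b, codes s b).
    by exists b => c /codes_fun; exact.
  by exists w0 => b sb; case: ns; exists b.
have [g gP] := choice ex_g.
have [b [Sb gb]] := S_stat (club_closed_under W1 g).
have [e eb] := J0_omega Sb.
have [|i ie imin] := @well_order_min _ _ (fun i => fst_seq (a i) = e) wo.
  by have [i ai] := surj (with_bits e xpred0); exists i; rewrite ai.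
have [||k kP] := isolated_separated _ _ (iso i).
- by rewrite ie eb.
- move=> t [j /= ji <-]; rewrite ie => /imin.
  by rewrite leNgt ji.
pose s := mkseq (nu b) k.
have [j] : exists j, above s j by exists i; rewrite /above ie /= eb /= size_mkseq.
have sb : codes s b.
  split=> //; exists i; split; last by rewrite ie.
    by rewrite /above ie /= eb /= size_mkseq.
  move=> l; rewrite /above size_mkseq => sl.
  rewrite leNgt; apply/negP => li.
  apply: (kP (a l)); first by exists l.
  by apply: J0_inj; rewrite sl ie /= eb.
have := gb s; rewrite -(gP _ _ sb) ltxx => H _; apply/notF/H.
by move=> x /mapP[n _ ->]; exact: nu_lt.
Qed.

End NotConstructible.

Theorem mainTheorem6 (d : Order.disp_t) (W : orderType d) (W_omega1 : is_omega1 W)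
    (S : set W) (S_limit : S `<=` limit_ordinals) (S_stat : stationary S)
    (L : W -> set W) (L_ladder : ladder_system S L)
    (nu : W -> nat -> W) (nu_enum : forall a, S a -> enumerates (nu a) (L a)) :
  let A := ladder_structure S nu in
  let T := theory_of A in
  [/\ has_size_continuum (ladder_language S nu),
      (is_model A T /\ atomic A) /\
      (forall N : structure (ladder_language S nu),
         is_model N T -> atomic N -> isomorphic N A),
      prime_model A
    & ~ constructible A].
Proof.
move=> A T; split.
- have [b Sb] := stationary_nonempty W_omega1 S_stat.
  have [e eb] := J0_omega nu_enum Sb.
  by apply: (ladder_language_size W_omega1 (e := e)); rewrite eb.
- split; first by split; [move=> p | exact: ladder_atomic].
  by move=> N /complete_theory NA; exact: atomic_isomorphic.
- exact: elementary_image.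
- exact: (ladder_not_constructible W_omega1 S_stat L_ladder).
Qed.
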